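(* Let $L/K$ be a finite separable field extension of degree $[L:K]=p^e$, where $p$ is an odd prime and $e\geq 1$, and suppose that $L/K$ admits a Hopf--Galois structure of cyclic type. Let $\widetilde{L}$ be the normal closure of $L/K$. Then for every extension $L'/K$ parallel to $L/K$, the following are equivalent: (1) $L'/K$ admits a Hopf--Galois structure of cyclic type; (2) $L'/K$ is conjugate to $L/K$, i.e. $L'=g(L)$ for some $g\in \mathrm{Gal}(\widetilde{L}/K)$.
   Context: For a finite separable extension $L/K$ with normal closure $\widetilde{L}$, put $G=\mathrm{Gal}(\widetilde{L}/K)$ and $G'=\mathrm{Gal}(\widetilde{L}/L)$, and let $\lambda:G\to\mathrm{Sym}(G/G')$, $\lambda(g)(hG')=ghG'$. By Greither--Pareigis, Hopf--Galois structures on $L/K$ correspond to regular subgroups $N$ of $\mathrm{Sym}(G/G')$ (transitive with trivial point stabilisers) normalised by $\lambda(G)$; the isomorphism class of $N$ is the type of the structure. Thus ''$L/K$ admits a Hopf--Galois structure of cyclic type'' means there is such a regular subgroup $N$ which is cyclic (necessarily of order $[L:K]$). An extension $L'/K$ is parallel to $L/K$ if $L'$ is an intermediate field of $\widetilde{L}/K$ with $[L':K]=[L:K]$. *)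

(* Defs.v *)
From HB Require Import structures.
From mathcomp Require Import all_boot all_order all_algebra all_fingroup all_solvable all_field.
Set Implicit Arguments. Unset Strict Implicit. Unset Printing Implicit Defensive.
Import GRing.Theory.
Local Open Scope ring_scope.

Definition coset_sp (gT : finGroupType) (H G : {set gT}) : predArgType :=
  {A : {set gT} | A \in lcosets H G}.

(* lambda(g) : h G' |-> g h G'  (for g in G this stays in G/G'). *)
Definition lam (gT : finGroupType) (H G : {set gT}) (g : gT)
    (A : coset_sp H G) : coset_sp H G :=
  insubd A (g *: val A)%g.

(* Greither--Pareigis: a Hopf--Galois structure of cyclic type corresponds to
   a regular subgroup N of Sym(G/G') normalised by lambda(G), with N cyclic. *)
Definition GP_cyclic_type (gT : finGroupType) (G H : {set gT}) : Prop :=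
  exists N : {group {perm coset_sp H G}},
    [/\ (forall x y : coset_sp H G, exists2 n, n \in N & n x = y),
        (forall n x, n \in N -> n x = x -> n = 1%g),
        (forall g n, g \in G -> n \in N ->
           exists2 m, m \in N & forall x, m x = lam g (n (lam g^-1 x))) &
        cyclic N].

Section NormalClosure.
Variables (F0 : fieldType) (Lt : splittingFieldType F0).

Definition normal_closure (K E M : {subfield Lt}) : Prop :=
  [/\ galois K M, (E <= M)%VS &
      forall M' : {subfield Lt}, galois K M' -> (E <= M')%VS -> (M <= M')%VS].

Definition HGS_cyclic (K E : {subfield Lt}) : Prop :=
  (K <= E)%VS /\
  exists M : {subfield Lt}, normal_closure K E M /\
    GP_cyclic_type 'Gal(M / K)%g 'Gal(M / E)%g.
End NormalClosure.

(* Main.v *)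
Require Import Defs.
From HB Require Import structures.
From mathcomp Require Import all_boot all_order all_algebra all_fingroup all_solvable all_field.
From mathcomp Require Import ring zify.

(* Write q = p ^ e, G = Gal(M/K), H = Gal(M/L) and H' = Gal(M/L').  A structure
   of cyclic type on L/K identifies G/H with Z/q so that G acts by affine maps
   x |-> u x + c, faithfully because M is the normal closure of L/K; one on
   L'/K gives an affine action of G on G/H'.  A p-element s of G moving 0 to 1
   in G/H' has s ^ (p ^ (e-1)) outside H', while this power acts on G/H as a
   translation by a multiple of p ^ (e-1).  Hence H' contains no nontrivial
   translation of G/H: otherwise some power of that translation would be equal
   to s ^ (p ^ (e-1)).  As p is odd, 1 + u + ... + u ^ (p ^ j - 1) is p ^ j
   times a unit when u = 1 mod p, so an element x |-> u x + c of H' without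
   fixed point would have a power that is a nontrivial translation.  Finally
   (Z/q)^* is cyclic, so up to translations H' is generated by one element and
   fixes a point of G/H: H' lies in a conjugate of H, and has the same order. *)

Set Implicit Arguments. Unset Strict Implicit. Unset Printing Implicit Defensive.
Import GRing.Theory.

(** * Geometric sums and units modulo an odd prime power *)

Section GeometricSums.
Variable p : nat.
Hypotheses (p_pr : prime p) (p_odd : odd p).

Lemma expn_1_mod_sqr a i : (p * a).+1 ^ i = i * (p * a) + 1 %[mod p ^ 2].
Proof.
elim: i => [|i IHi]; first by rewrite expn0.
rewrite expnS -modnMmr IHi modnMmr.
rewrite (_ : _ * _ = (i * a * a) * p ^ 2 + (i.+1 * (p * a) + 1)); last by lia.
by rewrite modnMDl.
Qed.

(** Modulo [p ^ 2] the sum is [p] plus [p * a] times 0 + 1 + ... + (p - 1), and [p] divides that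
    last sum because [p] is odd. *)
Lemma geometric_sum_prime a :
  exists w, \sum_(i < p) (p * a).+1 ^ i = p * (p * w).+1.
Proof.
have p_gt1 := prime_gt1 p_pr.
have Dsum: \sum_(i < p) (p * a).+1 ^ i = p %[mod p ^ 2].
  rewrite -modn_summ (eq_bigr (fun i : 'I_p => (i * (p * a) + 1) %% p ^ 2)).
    rewrite modn_summ big_split /= sum1_card card_ord -big_distrl /=.
    have /dvdnP[q Dq]: p %| \sum_(i < p) i.
      rewrite -(big_mkord predT id) /= bin2_sum prime_dvd_bin //=.
      by case: (p) p_odd p_gt1 => [|[|[]]].
    by rewrite Dq (_ : _ * _ = q * a * p ^ 2); [rewrite modnMDl | lia].
  by move=> i _; exact: expn_1_mod_sqr.
(* Subtraction is truncated, so turning the congruence into a divisibility needs this bound. *)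
have le_p: p <= \sum_(i < p) (p * a).+1 ^ i.
  rewrite -{1}[p]card_ord -sum1_card; apply: leq_sum => i _.
  by rewrite expn_gt0.
move/eqP: Dsum; rewrite eqn_mod_dvd // => /dvdnP[w Dw].
by exists w; lia.
Qed.

Lemma geometric_sumM (u m k : nat) :
  \sum_(i < m * k) u ^ i = (\sum_(i < m) u ^ i) * \sum_(i < k) (u ^ m) ^ i.
Proof.
elim: k => [|k IHk]; first by rewrite muln0 !big_ord0 muln0.
rewrite mulnS addnC big_split_ord IHk big_ord_recr mulnDr /=; congr (_ + _).
by rewrite big_distrl /=; apply: eq_bigr => i _; rewrite expnD expnM mulnC.
Qed.

(** Induction on [j]: the sum of length [p ^ j.+1] is the one of length [p ^ j] times a sum of [p]
    powers of [u ^ (p ^ j)], which is again 1 mod [p]. *)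
Lemma geometric_sum_primeX u j : u = 1 %[mod p] ->
  exists2 w, coprime p w & \sum_(i < p ^ j) u ^ i = p ^ j * w.
Proof.
move=> u1; elim: j => [|j [w cpw IHj]].
  by exists 1; [exact: coprimen1 | rewrite big_ord1].
have p_gt1 := prime_gt1 p_pr.
have uj1: u ^ (p ^ j) = 1 %[mod p] by rewrite -modnXm u1 modnXm exp1n.
have [a Da]: exists a, u ^ (p ^ j) = (p * a).+1.
  exists (u ^ p ^ j %/ p).
  by rewrite {1}(divn_eq (u ^ p ^ j) p) uj1 modn_small // addn1 mulnC.
have [v Dv] := geometric_sum_prime a.
exists (w * (p * v).+1); last by rewrite expnSr geometric_sumM IHj Da Dv; lia.
by rewrite coprimeMr cpw -addn1 mulnC /coprime gcdnMDl gcdn1.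
Qed.

End GeometricSums.

Local Open Scope group_scope.

(** The units are the automorphisms of a cyclic group of order [q], whose structure is known for
    [p]-groups. *)
Lemma units_Zp_pgroup_cyclic p e :
  prime p -> odd p -> cyclic (units_Zp (p ^ e)%N).
Proof.
move=> p_pr p_odd; set q := (p ^ e)%N.
case: (posnP e) => [e0 | e_gt0].
  (* By convention ['Z_1] is the same type as ['Z_2]. *)
  by have := units_Zp_cyclic (isT : prime 2); rewrite /q e0 expn0.
have q_gt1: (1 < q)%N by rewrite -(exp1n e) ltn_exp2r ?prime_gt1.
have ox: #[Zp1 : 'Z_q] = q by rewrite order_Zp1 Zp_cast.
rewrite -ox (isog_cyclic (Zp_unit_isog _)).
set G := <[_]>%G; have oG: #|G| = q by exact: ox.
have pG: p.-group G by rewrite /pgroup oG pnatX pnat_id.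
have ntG: G :!=: 1%g by rewrite -cardG_gt1 oG.
have [mA [_ [_ cycF _ _]]] :=
  cyclic_pgroup_Aut_structure pG (cycle_cyclic _) ntG.
case: ifP => _ => [defA | [t [_ _ _]]]; first by move: cycF; rewrite -defA.
by rewrite p_odd => -[[]].
Qed.

(** * Affine actions on [Z/n] *)

Section AffineActions.
Local Open Scope ring_scope.

(* [f] is the action of [G] on [G/H], transported along a bijection from ['Z_n]
   sending [0] to the coset [H]. *)
Definition affine_action (gT : finGroupType) (G H : {set gT}) (n : nat)
    (f : gT -> 'Z_n -> 'Z_n) : Prop :=
  [/\ {in G &, forall g h x, f (g * h)%g x = f g (f h x)},
      {in G, forall g, exists u c, forall x, f g x = u * x + c},
      (forall x, exists2 g, g \in G & f g 0 = x) &
      {in G, forall g, (g \in H) = (f g 0 == 0)}].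

Variables (gT : finGroupType) (n : nat) (G : {group gT}) (H : {set gT}).
Variable f : gT -> 'Z_n -> 'Z_n.
Hypothesis aff : affine_action G H f.

Definition lin g := f g 1 - f g 0.

Lemma affE g x : g \in G -> f g x = lin g * x + f g 0.
Proof.
by case: aff => _ affG _ _ /affG[u [c Df]]; rewrite /lin !Df; ring.
Qed.

Lemma affM g h x : g \in G -> h \in G -> f (g * h)%g x = f g (f h x).
Proof. by case: aff => fM _ _ _ /fM fgM /fgM->. Qed.

Lemma aff1 x : f 1%g x = x.
Proof.
by case: aff => fM _ trG _; have [g Gg <-] := trG x; rewrite -fM ?mul1g.
Qed.

Lemma affK g x : g \in G -> f g^-1%g (f g x) = x.
Proof. by move=> Gg; rewrite -affM ?groupV // mulVg aff1. Qed.

Lemma lin1 : lin 1%g = 1.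
Proof. by rewrite /lin !aff1 subr0. Qed.

Lemma linM g h : g \in G -> h \in G -> lin (g * h)%g = lin g * lin h.
Proof.
move=> Gg Gh; rewrite {1}/lin !affM // (affE (f h 1)) // (affE (f h 0)) // /lin.
by ring.
Qed.

Lemma linX g k : g \in G -> lin (g ^+ k)%g = lin g ^+ k.
Proof.
move=> Gg; elim: k => [|k IHk]; first exact: lin1.
by rewrite expgS linM ?groupX // IHk exprS.
Qed.

Lemma lin_unit g : g \in G -> lin g \is a GRing.unit.
Proof.
move=> Gg; apply/unitrPr; exists (lin g^-1%g).
by rewrite -linM ?groupV // mulgV lin1.
Qed.

Lemma affX g k x : g \in G ->
  f (g ^+ k)%g x = lin g ^+ k * x + f g 0 * \sum_(i < k) lin g ^+ i.
Proof.
move=> Gg; elim: k x => [|k IHk] x.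
  by rewrite big_ord0 mulr0 addr0 expr0 mul1r aff1.
by rewrite expgSr affM ?groupX // IHk (affE x) // big_ord_recr exprSr /=; ring.
Qed.

Lemma aff_fixX g k x : g \in G -> f g x = x -> f (g ^+ k)%g x = x.
Proof.
move=> Gg fgx; elim: k => [|k IHk]; first exact: aff1.
by rewrite expgS affM ?groupX // IHk.
Qed.

(** On [G] the default value is never taken, so this is a group morphism there. *)
Definition lin_units g : {unit 'Z_n} := insubd (1%g : {unit 'Z_n}) (lin g).

Lemma val_lin_units g : g \in G -> val (lin_units g) = lin g.
Proof. by move=> Gg; rewrite insubdK // lin_unit. Qed.

Fact lin_unitsM : {in G &, {morph lin_units : g h / (g * h)%g}}.
Proof.
move=> g h Gg Gh; apply: val_inj.
by rewrite /= !val_lin_units ?groupM ?linM.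
Qed.

Canonical lin_units_morphism := Morphism lin_unitsM.

(** The image of [K] in the cyclic group of units has a generator, and [h] lifts it. *)
Lemma lin_gen (K : {group gT}) : cyclic (units_Zp n) -> K \subset G ->
  exists2 h, h \in K & {in K, forall g, exists k, lin g = lin h ^+ k}.
Proof.
move=> cycU sKG; have [u Du] : exists u, lin_units @* K = <[u]>%g.
  by apply/cyclicP; apply: cyclicS cycU; rewrite subsetT.
have /morphimP[h Gh Kh Dh]: u \in lin_units @* K by rewrite Du cycle_id.
exists h => // g Kg; have Gg := subsetP sKG g Kg.
have: lin_units g \in <[u]>%g by rewrite -Du mem_morphim.
case/cycleP=> k Dk; exists k; rewrite -linX // -!val_lin_units ?groupX //.
by rewrite Dk Dh -morphX.
Qed.

End AffineActions.

(** * Powers and geometric sums in Z/q for elements congruent to 1 mod p *)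

Section ZpPrimePower.
Local Open Scope ring_scope.
Variables p e : nat.
Hypotheses (p_pr : prime p) (p_odd : odd p) (e_gt0 : (0 < e)%N).
Local Notation q := (p ^ e)%N.

Lemma primeX_gt1 : (1 < q)%N.
Proof. by rewrite -(exp1n e) ltn_exp2r ?prime_gt1. Qed.

Lemma natr_Zp_eq (a b : nat) : (a%:R == b%:R :> 'Z_q) = (a == b %[mod q])%N.
Proof. by rewrite -val_eqE /= !val_Zp_nat // primeX_gt1. Qed.

Lemma natr_Zp_eq0 (a : nat) : (a%:R == 0 :> 'Z_q) = (q %| a)%N.
Proof. by rewrite (natr_Zp_eq a 0) mod0n. Qed.

Lemma Zp_primeX_split (c : 'Z_q) :
  exists b m, [/\ (b <= e)%N, coprime p m & c = (p ^ b * m)%:R].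
Proof.
have [->|nz_c] := eqVneq c 0.
  (* Zero is represented as [p ^ e * 1]. *)
  exists e, 1%N; split; rewrite ?coprimen1 //.
  by apply/esym/eqP; rewrite natr_Zp_eq0 muln1.
have c_gt0: (0 < val c)%N by rewrite lt0n.
have [m cpm Dc] := pfactor_coprime p_pr c_gt0.
exists (logn p (val c)), m; split=> //; last by rewrite mulnC -Dc natr_Zp.
apply: ltnW; rewrite -(ltn_exp2l _ _ (prime_gt1 p_pr)).
apply: leq_ltn_trans (_ : val c < q)%N.
  by rewrite dvdn_leq // pfactor_dvdnn.
by have := ltn_ord c; rewrite [X in (_ < X)%N -> _]Zp_cast ?primeX_gt1.
Qed.

Definition one_mod (u : 'Z_q) := val u = 1 %[mod p].

Lemma one_modP (u : 'Z_q) : one_mod u -> exists a : nat, u = (p * a).+1%:R.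
Proof.
rewrite /one_mod (modn_small (prime_gt1 p_pr)) => u1; exists (val u %/ p)%N.
have Du: val u = (p * (val u %/ p)).+1.
  by rewrite {1}(divn_eq (val u) p) u1 addn1 mulnC.
by rewrite -Du natr_Zp.
Qed.

Lemma one_mod_nat (a : nat) : (a = 1 %[mod p])%N -> one_mod a%:R.
Proof.
by rewrite /one_mod /= val_Zp_nat ?primeX_gt1 // modn_dvdm // dvdn_exp.
Qed.

Lemma sum_one_mod u j : one_mod u ->
  exists2 w, coprime p w & \sum_(i < p ^ j) u ^+ i = (p ^ j * w)%:R.
Proof.
move=> /(geometric_sum_primeX p_pr p_odd j)[w cpw Dw]; exists w => //.
by rewrite -Dw natr_sum; apply: eq_bigr => i _; rewrite natrX natr_Zp.
Qed.

(** The power minus 1 is [u - 1] times a geometric sum divisible by [p ^ (e - b)], hence a multiple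
    of [p ^ e]. *)
Lemma one_modX u b (a : nat) : one_mod u -> (b <= e)%N ->
  u - 1 = (p ^ b * a)%:R -> u ^+ (p ^ (e - b)) = 1.
Proof.
move=> u1 le_be Du; apply/eqP; rewrite -subr_eq0 subrX1 Du.
have [w _ ->] := sum_one_mod (e - b) u1.
rewrite -natrM natr_Zp_eq0 mulnACA -expnD subnKC //.
by rewrite dvdn_mulr.
Qed.

(** By Fermat, raising to the power [p ^ k] is the identity modulo [p]. *)
Lemma one_mod_pX u k : u ^+ (p ^ k) = 1 -> one_mod u.
Proof.
rewrite -{1}[u]natr_Zp -natrX => /eqP; rewrite (natr_Zp_eq _ 1) => /eqP Du.
have: (val u ^ (p ^ k) = 1 %[mod p])%N.
  by rewrite -(modn_dvdm _ (dvdn_exp e_gt0 (dvdnn p))) Du modn_dvdm // dvdn_exp.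
rewrite /one_mod => <-; elim: k {Du} => [|k IHk]; first by rewrite expn1.
by rewrite expnSr expnM fermat_little.
Qed.

End ZpPrimePower.

(** * Translations and fixed points modulo an odd prime power *)

Section AffinePrimePower.
Local Open Scope ring_scope.
Variables p e : nat.
Hypotheses (p_pr : prime p) (p_odd : odd p) (e_gt0 : (0 < e)%N).
Local Notation q := (p ^ e)%N.
Variables (gT : finGroupType) (G : {group gT}) (H : {set gT}).
Variable f : gT -> 'Z_q -> 'Z_q.
Hypothesis aff : affine_action G H f.

Lemma lin_pelt g : g \in G -> p.-elt g -> one_mod (lin f g).
Proof.
move=> Gg /p_natP[k og]; apply: (one_mod_pX p_pr e_gt0 (k := k)).
by rewrite -og -(linX aff) // expg_order (lin1 aff).
Qed.

(** Since [p] divides [lin f g - 1], the power [p ^ e.-1] kills the linear part; a geometric sum of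
    that length multiplies the constant term. *)
Lemma pelt_translation g : g \in G -> p.-elt g ->
  exists2 w, coprime p w
    & forall x, f (g ^+ (p ^ e.-1))%g x = x + f g 0 * (p ^ e.-1 * w)%:R.
Proof.
move=> Gg pg; have u1 := lin_pelt Gg pg.
have [w cpw Dw] := sum_one_mod p_pr p_odd e.-1 u1; exists w => // x.
rewrite (affX aff) // Dw; congr (_ + _).
have [a Du] := one_modP p_pr u1.
rewrite -subn1 (@one_modX _ _ p_pr p_odd e_gt0 _ 1 a) ?mul1r //.
by rewrite Du -natr1 addrK.
Qed.

Lemma translation_expg g k c : g \in G -> (forall x, f g x = x + c) ->
  forall x, f (g ^+ k)%g x = x + c *+ k.
Proof.
move=> Gg fg; elim: k => [|k IHk] x; first by rewrite (aff1 aff) addr0.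
by rewrite expgS (affM aff) ?groupX // IHk fg -addrA -mulrSr.
Qed.

(** If [h] acts by x |-> u x + c with u - 1 equal to [p ^ b] times a unit, a fixed point exists once
    [p ^ b] divides [c]. For [b > 0], [h ^+ (p ^ (e - b))] is the translation by
    [c * p ^ (e - b) * w] with [w] prime to [p]; its vanishing gives this divisibility. *)
Lemma affine_fixed_point (K : {group gT}) h :
    K \subset G -> h \in K ->
    {in K, forall g c, (forall x, f g x = x + c) -> c = 0} ->
  exists x, f h x = x.
Proof.
move=> sKG Kh trK; have Gh := subsetP sKG h Kh.
set u := lin f h; set c := f h 0.
have [b [m [le_be cpm Du]]] := Zp_primeX_split p_pr e_gt0 (u - 1).
have mU: m%:R \is a @GRing.unit 'Z_q.
  by rewrite unitZpE ?primeX_gt1 // coprimeXl.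
suffices [d Dc]: exists d, c = (p ^ b)%:R * d.
  (* Chosen so that (u - 1) y = c. *)
  pose y := m%:R^-1 * d; have Dd: d = m%:R * y by rewrite mulVKr.
  exists (- y); rewrite (affE aff) // -/u -/c Dc Dd -(subrK 1 u) Du natrM.
  ring.
have [->|b_gt0] := posnP b; first by exists c; rewrite expn0 mul1r.
have u1: one_mod u.
  rewrite -(subrK 1 u) Du natr1; apply: one_mod_nat => //.
  have /dvdnP[k ->]: (p %| p ^ b * m)%N by rewrite dvdn_mulr ?dvdn_exp.
  by rewrite -addn1 modnMDl.
have [w cpw Dw] := sum_one_mod p_pr p_odd (e - b) u1.
have /trK: (h ^+ (p ^ (e - b)))%g \in K by rewrite groupX.
move=> /(_ (c * (p ^ (e - b) * w)%:R)) c0.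
have [b' [m' [le_b'e cpm' Dc]]] := Zp_primeX_split p_pr e_gt0 c.
suffices le_bb': (b <= b')%N.
  exists (p ^ (b' - b) * m')%:R.
  by rewrite -natrM mulnA -expnD subnKC.
have /eqP: c * (p ^ (e - b) * w)%:R = 0.
  apply: c0 => x; rewrite (affX aff) // -/u -/c Dw.
  by rewrite (one_modX p_pr p_odd e_gt0 u1 le_be Du) mul1r.
rewrite Dc -natrM natr_Zp_eq0 // mulnACA -expnD Gauss_dvdl; last first.
  by rewrite coprimeXl // coprimeMr cpm' cpw.
by rewrite dvdn_Pexp2l ?prime_gt1 //; lia.
Qed.

Hypothesis faithful : {in G, forall g, f g =1 id -> g = 1%g}.

(* The translations by multiples of [p ^ e.-1] form the unique subgroup of
   order [p] of the group of all translations, so it lies in the group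
   generated by any nontrivial translation. *)
Lemma translation_eq0 (K : {group gT}) z (d : 'Z_q) h c :
    K \subset G -> z \in G -> z \notin K ->
    (forall x, f z x = x + d * (p ^ e.-1)%:R) ->
    h \in K -> (forall x, f h x = x + c) ->
  c = 0.
Proof.
move=> sKG Gz notKz fz Kh fh; have Gh := subsetP sKG h Kh.
have [b [m [le_be cpm Dc]]] := Zp_primeX_split p_pr e_gt0 c.
have [Deb|ne_be] := eqVneq b e.
  by apply/eqP; rewrite Dc natr_Zp_eq0 // Deb dvdn_mulr.
have mU: m%:R \is a @GRing.unit 'Z_q.
  by rewrite unitZpE ?primeX_gt1 // coprimeXl.
(* Multiplying [c = p ^ b * m] by [k] cancels [m] and gives [d * p ^ e.-1], the translation part of
   [z]. *)
pose r := val (m%:R^-1 * d); pose k := (p ^ (e.-1 - b) * r)%N.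
case/negP: notKz; suffices ->: z = (h ^+ k)%g by rewrite groupX.
have Dck: c *+ k = d * (p ^ e.-1)%:R.
  have Dpe: (p ^ e.-1)%:R = (p ^ b)%:R * (p ^ (e.-1 - b))%:R :> 'Z_q.
    by rewrite -natrM -expnD subnKC // -ltnS prednK // ltn_neqAle ne_be.
  rewrite -[c *+ k]mulr_natr Dc /k !natrM /r natr_Zp Dpe.
  rewrite -[RHS](mulVKr mU); ring.
apply: (mulgI z^-1%g); rewrite mulVg; apply/esym/faithful => [|x].
  by rewrite groupM ?groupV ?groupX.
rewrite (affM aff) ?groupV ?groupX // (translation_expg _ Gh fh) Dck -fz.
exact: affK aff _ _ Gz.
Qed.

(** Each [g] in [K] is [t * h ^+ k] with [t] in [K] of linear part 1. Such a [t] is a translation,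
    hence acts trivially, so a fixed point of [h] serves for all of [K]. *)
Lemma affine_common_fixed_point (K : {group gT}) :
    K \subset G -> {in K, forall g c, (forall x, f g x = x + c) -> c = 0} ->
  exists x, {in K, forall g, f g x = x}.
Proof.
move=> sKG trK.
have [h Kh Dlin] := lin_gen aff (units_Zp_pgroup_cyclic e p_pr p_odd) sKG.
have [x fhx] := affine_fixed_point sKG Kh trK.
exists x => g Kg; have [k Dg] := Dlin g Kg.
have [Gg Gh] := (subsetP sKG g Kg, subsetP sKG h Kh).
pose t := (g * h ^- k)%g; have Kt: t \in K by rewrite groupM ?groupV ?groupX.
have Gt := subsetP sKG t Kt.
have lin_t: lin f t = 1.
  rewrite (linM aff) ?groupV ?groupX // Dg -(linX aff) //.
  by rewrite -(linM aff) ?groupV ?groupX // mulgV (lin1 aff).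
have ft y : f t y = y + f t 0 by rewrite (affE aff) // lin_t mul1r.
have t0 := trK t Kt _ ft.
rewrite -(mulgKV (h ^+ k)%g g) (affM aff) ?groupX // (aff_fixX aff) //.
by rewrite ft t0 addr0.
Qed.

End AffinePrimePower.

(** * Conjugacy of the two point stabilisers *)

Section Conjugacy.
Local Open Scope ring_scope.
Variables p e : nat.
Hypotheses (p_pr : prime p) (p_odd : odd p) (e_gt0 : (0 < e)%N).
Local Notation q := (p ^ e)%N.
Variables (gT : finGroupType) (G H K : {group gT}).
Hypotheses (sHG : H \subset G) (sKG : K \subset G).
Hypotheses (iHG : #|G : H|%g = q) (iKG : #|G : K|%g = q).

(** As [K] has [p]-power index, [G = P * K] for a Sylow [p]-subgroup [P]; the factor in [K] fixes
    0. *)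
Lemma pelt_lift (f : gT -> 'Z_q -> 'Z_q) : affine_action G K f ->
  exists s, [/\ s \in G, p.-elt s & f s 0 = 1].
Proof.
move=> aff; have [fM _ trG stab] := aff.
have [P sylP] := Sylow_exists p G; have [sPG pP p'iP] := and3P sylP.
have PK: (P * K)%g = G.
  apply: coprime_index_mulG => //; rewrite iKG coprime_sym.
  by rewrite (pnat_coprime (pi := p)) // pnatX pnat_id.
have [g Gg fg] := trG 1; have: g \in (P * K)%g by rewrite PK.
case/mulsgP=> s k Ps Kk Dg; exists s.
have [Gs Gk] := (subsetP sPG s Ps, subsetP sKG k Kk).
split=> //; first exact: mem_p_elt pP Ps.
move: Kk; rewrite stab // => /eqP k0.
by rewrite -fg Dg fM // k0.
Qed.

Lemma affine_stabiliser_conj (f f' : gT -> 'Z_q -> 'Z_q) :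
    affine_action G H f -> affine_action G K f' ->
    {in G, forall g, f g =1 id -> g = 1%g} ->
  exists2 g, g \in G & K :=: H :^ g.
Proof.
move=> aff aff' faithful; have [s [Gs ps fs]] := pelt_lift aff'.
pose z := (s ^+ (p ^ e.-1))%g; have Gz: z \in G by rewrite groupX.
(* In the action on G/K, [z] moves 0 to [p ^ e.-1 * w] with [w] prime to [p], which is nonzero. *)
have notKz: z \notin K.
  have [w cpw fz] := pelt_translation p_pr p_odd e_gt0 aff' Gs ps.
  case: (aff') => _ _ _ -> //; rewrite fz fs mul1r add0r natr_Zp_eq0 //.
  rewrite Gauss_dvdl ?coprimeXl // dvdn_Pexp2l ?prime_gt1 //; lia.
have [w _ fz] := pelt_translation p_pr p_odd e_gt0 aff Gs ps.
have trK: {in K, forall g c, (forall x, f g x = x + c) -> c = 0}.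
  move=> h Kh c; pose d := f s 0 * w%:R.
  apply: (translation_eq0 _ _ aff faithful sKG Gz notKz (d := d)) Kh => // x.
  by rewrite fz mulnC natrM mulrA.
have [x fixKx] := affine_common_fixed_point p_pr p_odd e_gt0 aff sKG trK.
(* As [r] sends 0 to [x], the stabiliser of [x] is [H :^ r^-1]; it contains [K] and has the same
   order. *)
case: (aff) => _ _ /(_ x)[r Gr fr] stab; exists r^-1%g; first by rewrite groupV.
apply/eqP; rewrite eqEcard cardJg; apply/andP; split; last first.
  by rewrite -(leq_pmul2r (indexg_gt0 G K)) Lagrange // iKG -iHG Lagrange.
apply/subsetP=> g Kg; have Gg := subsetP sKG g Kg.
rewrite mem_conjgV stab ?groupJ //.
rewrite !(affM aff) ?groupM ?groupV // fr fixKx // -fr.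
by rewrite -(affM aff) ?groupV // mulVg (aff1 aff).
Qed.

End Conjugacy.

(** * Cyclic regular subgroups give affine actions *)

Section CosetSpace.
Variables (gT : finGroupType) (G H : {group gT}).
Local Notation X := (coset_sp H G).

Lemma val_lam g (A : X) : g \in G -> val (lam g A) = g *: val A.
Proof.
move=> Gg; rewrite insubdK //; have /lcosetsP[x Gx ->] := valP A.
by apply/lcosetsP; exists (g * x); rewrite ?groupM // lcosetM.
Qed.

Lemma lamM g h (A : X) : g \in G -> h \in G -> lam (g * h) A = lam g (lam h A).
Proof.
by move=> Gg Gh; apply: val_inj; rewrite !val_lam ?groupM // lcosetM.
Qed.

Lemma lam1 (A : X) : lam 1 A = A.
Proof. by apply: val_inj; rewrite val_lam // lcoset1. Qed.

Lemma lamK g : g \in G -> cancel (@lam _ H G g) (lam g^-1).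
Proof. by move=> Gg A; rewrite -lamM ?groupV // mulVg lam1. Qed.

Lemma card_coset_sp : #|{: X}| = #|G : H|.
Proof. by rewrite -card_lcosets card_sub. Qed.

Lemma base_coset_subproof : (H : {set gT}) \in lcosets H G.
Proof. by apply/lcosetsP; exists 1; rewrite ?lcoset1. Qed.

Definition base_coset : X := Sub (H : {set gT}) base_coset_subproof.

Lemma lam_base_eq g : g \in G -> (lam g base_coset == base_coset) = (g \in H).
Proof.
move=> Gg; rewrite -val_eqE /= val_lam //=.
rewrite -[X in _ == X](lcoset1 (H : {set gT})) (sameP eqP lcoset_eqP).
by rewrite lcoset1.
Qed.

Lemma lam_trans (A : X) : exists2 g, g \in G & lam g base_coset = A.
Proof.
have /lcosetsP[g Gg Dg] := valP A; exists g => //.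
by apply: val_inj; rewrite val_lam.
Qed.

(** A generator [t] of [N] labels the cosets by x |-> [(t ^+ x) H]. Conjugation by [lam g] sends [t]
    to some [t ^+ u], so [g] acts on labels by x |-> u x + c, where [c] is the label of [g H]. *)
Lemma GP_cyclic_affine n : (1 < n)%N -> #|G : H| = n -> GP_cyclic_type G H ->
  exists f : gT -> 'Z_n -> 'Z_n, affine_action G H f.
Proof.
move=> n_gt1 iHG [N [trN freeN nN /cyclicP[t DN]]].
have tX k : t ^+ k \in N by rewrite DN mem_cycle.
have oN: #|N| = n.
  rewrite -iHG -card_coset_sp -cardsT.
  have ->: [set: X] = [set (m : {perm X}) base_coset | m in N].
    apply/setP=> x; rewrite inE; apply/esym/imsetP.
    by have [m Nm <-] := trN base_coset x; exists m.
  rewrite card_in_imset // => m1 m2 Nm1 Nm2 eq_m.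
  apply/eqP; rewrite eq_mulgV1; apply/eqP.
  apply: (freeN _ base_coset); rewrite ?groupM ?groupV //.
  by rewrite permM eq_m permK.
have ot: #[t] = n by rewrite orderE -DN.
pose pt (x : 'Z_n) : X := (t ^+ x) base_coset.
have pt_inj: injective pt.
  move=> x y; rewrite /pt => eq_xy; have: t ^+ x == t ^+ y.
    rewrite eq_mulgV1; apply/eqP.
    apply: (freeN _ base_coset); rewrite ?groupM ?groupV //.
    by rewrite permM eq_xy permK.
  have ltn (z : 'Z_n) : (z < n)%N by have := ltn_ord z; rewrite {2}Zp_cast.
  by rewrite eq_expg_mod_order ot !modn_small // => /eqP/val_inj.
have [dx ptK dxK] : bijective pt.
  apply: inj_card_bij => //.
  by rewrite card_coset_sp iHG card_ord Zp_cast.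
have pt_nat k : pt k%:R%R = (t ^+ k) base_coset.
  by rewrite /pt val_Zp_nat // -ot expg_mod_order.
exists (fun g x => dx (lam g (pt x))); split=> [g h Gg Gh x|g Gg|x|g Gg].
- by rewrite lamM // dxK.
- have [m Nm Dm] := nN g t Gg (tX 1%N).
  have {}Dm y : lam g (t y) = m (lam g y) by rewrite Dm lamK.
  have /cycleP[u Du]: m \in <[t]> by rewrite -DN.
  exists u%:R%R, (dx (lam g (pt 0%R))) => x.
  apply: (can_inj ptK); rewrite dxK.
  set c := dx _; rewrite -[x in RHS]natr_Zp -[c]natr_Zp -natrM -natrD pt_nat.
  rewrite addnC expgD permM -/(pt c) dxK expgM -Du /pt.
  (* What remains is that [lam g] carries the action of [t ^+ k] to that of [m ^+ k]. *)
  elim: (val x) => [|k IHk]; first by rewrite !expg0 !perm1.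
  by rewrite !expgSr !permM Dm IHk.
- have [g Gg Dg] := lam_trans (pt x); exists g => //.
  by rewrite [pt 0%R]perm1 Dg ptK.
rewrite -lam_base_eq // -(inj_eq (can_inj ptK)) dxK.
by rewrite [pt 0%R]perm1.
Qed.

End CosetSpace.

(** * Transport of structures along an equivariant bijection *)

Section PermTransport.
Variables (X Y : finType) (phi : X -> Y) (psi : Y -> X).
Hypotheses (phiK : cancel phi psi) (psiK : cancel psi phi).

Fact perm_transport_inj (m : {perm X}) : injective (phi \o m \o psi).
Proof.
exact: inj_comp (inj_comp (can_inj phiK) perm_inj) (can_inj psiK).
Qed.

Definition perm_transport m : {perm Y} := perm (@perm_transport_inj m).

Lemma perm_transportE m y : perm_transport m y = phi (m (psi y)).
Proof. by rewrite permE. Qed.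

Fact perm_transportM :
  {in [set: {perm X}] &, {morph perm_transport : m1 m2 / m1 * m2}}.
Proof.
by move=> m1 m2 _ _; apply/permP=> y; rewrite permM !perm_transportE permM phiK.
Qed.

Canonical perm_transport_morphism := Morphism perm_transportM.

End PermTransport.

Section GPTransport.
Variables (gT : finGroupType) (G H K : {group gT}).
Variables (phi : coset_sp H G -> coset_sp K G).
Variables (psi : coset_sp K G -> coset_sp H G).
Hypotheses (phiK : cancel phi psi) (psiK : cancel psi phi).
Hypothesis phi_lam : {in G, forall g A, phi (lam g A) = lam g (phi A)}.

Lemma GP_cyclic_transport : GP_cyclic_type G H -> GP_cyclic_type G K.
Proof.
case=> N [trN freeN nN cycN].
exists (perm_transport_morphism phiK psiK @* N)%G; split=> [x y|n' x|g n' Gg|].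
- have [n Nn Dn] := trN (psi x) (psi y).
  exists (perm_transport phiK psiK n); first by rewrite mem_morphim ?inE.
  by rewrite perm_transportE Dn psiK.
- case/morphimP=> n _ Nn -> /=; rewrite perm_transportE => fix_n.
  rewrite (freeN n (psi x)) //.
    exact: (morph1 (perm_transport_morphism _ _)).
  by rewrite -[LHS]phiK fix_n.
- case/morphimP=> n _ Nn -> /=; have [m Nm Dm] := nN g n Gg Nn.
  exists (perm_transport phiK psiK m); first by rewrite mem_morphim ?inE.
  move=> x; rewrite !perm_transportE Dm phi_lam //.
  congr (lam g (phi (n _))); apply: (can_inj phiK).
  by rewrite phi_lam ?groupV // !psiK.
exact: morphim_cyclic.
Qed.

End GPTransport.

Lemma lcosets_rcosetJ (gT : finGroupType) (G : {group gT}) (A B : {set gT}) g :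
  g \in G -> B \in lcosets A G -> B :* g \in lcosets (A :^ g) G.
Proof.
move=> Gg /lcosetsP[x Gx ->]; apply/lcosetsP.
exists (x * g); first exact: groupM.
by rewrite conjsgE -lcosetM mulgK mulgA.
Qed.

(** The map xH |-> xHg = (xg)(H :^ g) is a bijection of coset spaces commuting with left
    translations. *)
Lemma GP_cyclicJ (gT : finGroupType) (G H : {group gT}) g :
  g \in G -> GP_cyclic_type G H -> GP_cyclic_type G (H :^ g).
Proof.
move=> Gg.
have psi_sub (A : coset_sp (H :^ g) G) : val A :* g^-1 \in lcosets H G.
  have Gg' : g^-1 \in G by rewrite groupV.
  by have := lcosets_rcosetJ Gg' (valP A); rewrite conjsgK.
pose phi (A : coset_sp H G) : coset_sp (H :^ g)%G G :=
  Sub (val A :* g) (lcosets_rcosetJ Gg (valP A)).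
pose psi (A : coset_sp (H :^ g)%G G) : coset_sp H G :=
  Sub (val A :* g^-1) (psi_sub A).
apply: (@GP_cyclic_transport _ G H (H :^ g)%G phi psi) => [A|A|h Gh A].
- by apply: val_inj; rewrite /= rcosetK.
- by apply: val_inj; rewrite /= rcosetKV.
by apply: val_inj; rewrite val_lam //= val_lam // mulgA.
Qed.

(** * Normal closures *)

Section NormalClosures.
Variables (F0 : fieldType) (Lt : splittingFieldType F0).
Implicit Types K L M E : {subfield Lt}.

Lemma normal_closure_uniq K L M1 M2 :
  normal_closure K L M1 -> normal_closure K L M2 -> M1 = M2.
Proof.
case=> gal1 sLM1 min1 [gal2 sLM2 min2].
by apply/val_inj/subv_anti; rewrite min1 ?min2.
Qed.

Lemma HGS_cyclic_GP K L M : normal_closure K L M -> HGS_cyclic K L ->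
  GP_cyclic_type 'Gal(M / K) 'Gal(M / L).
Proof. by move=> clM [_ [M1 [/(normal_closure_uniq clM)<-]]]. Qed.

Lemma index_gal K L M : galois K M -> (K <= L)%VS -> (L <= M)%VS ->
  #|'Gal(M / K) : 'Gal(M / L)| = \dim_K L.
Proof.
move=> galKM sKL sLM; rewrite -(dim_fixed_galois galKM) ?galS //.
by have /galois_fixedField->: galois L M by apply: galoisS galKM; rewrite sKL.
Qed.

(** The fixed field of the core is Galois over [K] and contains [L], so by minimality it contains
    [M]. *)
Lemma gcore_gal_normal_closure K L M : (K <= L)%VS -> normal_closure K L M ->
  gcore 'Gal(M / L) 'Gal(M / K) = 1.
Proof.
move=> sKL [galKM sLM minM].
have sGLK : 'Gal(M / L) \subset 'Gal(M / K) by exact: galS.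
set D := gcore _ _; have nsD: D <| 'Gal(M / K) by exact: gcore_normal.
have sMD: (M <= fixedField D)%VS.
  apply: (minM (fixedField_aspace D)).
    exact: (normal_fixedField_galois galKM nsD).
  by rewrite -galois_connection ?gcore_sub.
apply/trivgP/subsetP=> x Dx; rewrite inE; apply/gal_eqP=> a Ma.
by have [_ ->] := mem_fixedFieldP (subvP sMD a Ma); rewrite ?gal_id.
Qed.

Lemma affine_faithful (gT : finGroupType) (G H : {group gT}) n
    (f : gT -> 'Z_n -> 'Z_n) :
    affine_action G H f -> gcore H G = 1 ->
  {in G, forall g, f g =1 id -> g = 1}.
Proof.
move=> aff core1 g Gg fg; apply/set1P; rewrite -[[set 1]]core1.
apply/bigcapP=> x Gx; case: (aff) => _ _ _ stab.
rewrite mem_conjg stab ?groupJ ?groupV // conjgE invgK.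
rewrite !(affM aff) ?groupM ?groupV // fg -(affM aff) ?groupV //.
by rewrite mulgV (aff1 aff).
Qed.

(** Serves when the normal closure [E] of a parallel extension may be smaller than [M]: the action
    is inflated along restriction to [E], and fixing [L] pointwise can be tested on [E]. *)
Lemma affine_action_pullback K L M E n (f : gal_of E -> 'Z_n -> 'Z_n) :
    galois K M -> galois K E -> (K <= L)%VS -> (L <= E)%VS -> (E <= M)%VS ->
    affine_action 'Gal(E / K) 'Gal(E / L) f ->
  affine_action 'Gal(M / K) 'Gal(M / L) (f \o normalField_cast E (E:=M)).
Proof.
move=> galKM galKE sKL sLE sEM [fM affG trG stab].
have [sKE _ nKE] := and3P galKE; have sLM := subv_trans sLE sEM.
have sKEM: (K <= E <= M)%VS by rewrite sKE.
have castG g : g \in 'Gal(M / K) -> normalField_cast E g \in 'Gal(E / K).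
  move=> Gg; rewrite -(normalField_img galKM sKEM nKE).
  by apply/morphimP; exists g.
split=> [g h Gg Gh x|g Gg|x|g Gg] /=.
- by rewrite (normalField_castM sKEM nKE) // fM ?castG.
- exact/affG/castG.
- have [g] := trG x; rewrite -(normalField_img galKM sKEM nKE).
  by case/morphimP=> g' _ Gg' -> Dx; exists g'.
have castE := normalField_cast_eq sKEM nKE Gg.
rewrite -stab ?castG // !gal_kHom //; apply/kAHomP/kAHomP=> fixL a La.
  by rewrite castE ?fixL // (subvP sLE).
by rewrite -(castE a) ?fixL // (subvP sLE).
Qed.

Lemma sub_limg_gal K L M (g : gal_of M) : (K <= L)%VS -> (K <= M)%VS ->
  g \in 'Gal(M / K) -> (K <= g @: L)%VS.
Proof.
move=> sKL sKM Gg.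
have /fixedSpace_limg <-: (K <= fixedSpace g)%VS; last exact: limgS.
by apply/fixedSpacesP=> a; exact: (fixed_gal sKM Gg).
Qed.

(** Every [M'] Galois over [K] is stable under [g], so it contains [L] as soon as it contains
    [g(L)]. *)
Lemma normal_closure_conj K L L' M (g : gal_of M) :
    (K <= L)%VS -> g \in 'Gal(M / K) -> L' = (g @: L)%VS :> {vspace Lt} ->
  normal_closure K L M -> normal_closure K L' M.
Proof.
move=> sKL Gg DL' [galKM sLM minM]; split=> // [|M' galKM' sL'M'].
  by rewrite DL' -[in X in (_ <= X)%VS](limg_gal g) limgS.
have [sKM _ _] := and3P galKM; have [_ _ /forall_inP nKM'] := and3P galKM'.
apply: minM => //; have DM': (g @: M')%VS = M'.
  apply/eqP/nKM'; rewrite inE kAutfE; move: Gg; rewrite gal_kHom // => /kAHomP.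
  by move=> idKg; apply/kAHomP.
apply/subvP=> a La; have: g a \in (g @: M')%VS.
  by rewrite DM' (subvP sL'M') // DL' memv_img.
by case/memv_imgP=> b M'b /(lker0P (AEnd_lker0 _))->.
Qed.

End NormalClosures.

(** * Hopf--Galois structures of cyclic type on parallel extensions *)

Theorem theorem1p4 (F0 : fieldType) (Lt : splittingFieldType F0)
  (K L M : {subfield Lt}) (p e : nat) :
  prime p -> odd p -> (0 < e)%N ->
  (K <= L)%VS -> separable K L -> (\dim_K L = p ^ e)%N ->
  HGS_cyclic K L ->
  normal_closure K L M ->
  forall L' : {subfield Lt},
    (K <= L')%VS -> (L' <= M)%VS -> (\dim_K L' = \dim_K L)%N ->
    (HGS_cyclic K L' <->
     exists2 g : gal_of M, g \in 'Gal(M / K)%g & L' = (g @: L)%VS :> {vspace Lt}).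
Proof.
move=> p_pr p_odd e_gt0 sKL _ dimL hgsL clM L' sKL' sL'M; rewrite dimL => dimL'.
have q_gt1 := primeX_gt1 p_pr e_gt0.
have [galKM sLM _] := clM; have [sKM _ _] := and3P galKM.
have gpL := HGS_cyclic_GP clM hgsL.
split=> [[_ [E [clE gpL']]] | [g Gg DL']]; last first.
  split=> //; exists M; split; first exact: normal_closure_conj sKL Gg DL' clM.
  by rewrite DL' -gal_conjg; exact: GP_cyclicJ.
have [galKE sL'E minE] := clE; have sEM := minE M galKM sL'M.
have iL : #|'Gal(M / K) : 'Gal(M / L)| = (p ^ e)%N by rewrite index_gal.
have iL' : #|'Gal(M / K) : 'Gal(M / L')| = (p ^ e)%N by rewrite index_gal.
have iE : #|'Gal(E / K) : 'Gal(E / L')| = (p ^ e)%N by rewrite index_gal.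
have [f aff] := GP_cyclic_affine q_gt1 iL gpL.
have [f' affE] := GP_cyclic_affine q_gt1 iE gpL'.
have aff' := affine_action_pullback galKM galKE sKL' sL'E sEM affE.
have faithful := affine_faithful aff (gcore_gal_normal_closure sKL clM).
have [sHG sH'G] := (galS M sKL, galS M sKL').
have [g Gg Dg] := affine_stabiliser_conj p_pr p_odd e_gt0 sHG sH'G
  iL iL' aff aff' faithful.
exists g => //; have sgLM : (g @: L <= M)%VS.
  by rewrite -[in X in (_ <= X)%VS](limg_gal g) limgS.
have galL'M : galois L' M by apply: galoisS galKM; rewrite sKL'.
have galgLM : galois (g @: L)%AS M.
  by apply: galoisS galKM; rewrite /= (sub_limg_gal sKL sKM Gg) sgLM.
(* Both fields are the fixed fields of their groups, and Gal(M/g(L)) is the conjugate by [g] of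
   Gal(M/L). *)
move/galois_fixedField: galgLM => /= <-; move/galois_fixedField: galL'M => <-.
by rewrite -gal_conjg; congr fixedField.
Qed.
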